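(* Let $G$ be a finite group and let $H$ be a T.I. subgroup of $G$ which is also a Hall subgroup of $N_G(H)$. Then $H$ has a normal complement in $N_G(H)$ if and only if $H$ has a normal complement in $G$. Moreover, if $H$ is nonnormal in $G$ and $H$ has a normal complement in $N_G(H)$, then $H$ is a Frobenius complement.
   Context: A subgroup $H$ of a group $G$ is a T.I. subgroup if for every $x\in G$ the intersection $H\cap H^x$ is either $H$ or trivial. A Hall subgroup is a subgroup whose order is coprime to its index. A normal complement of a subgroup $H$ in a group $X\ge H$ is a normal subgroup $N$ of $X$ with $X=NH$ and $N\cap H=1$. The group $H$ is called a Frobenius complement if there exists a (nontrivial) finite group $K$ on which $H$ acts by automorphisms such that every nonidentity element of $H$ acts fixed point freely on $K$, i.e. fixes only the identity element of $K$. *)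

(* Defs.v *)
From mathcomp Require Import all_boot all_fingroup all_solvable.
Set Implicit Arguments.
Unset Strict Implicit.
Unset Printing Implicit Defensive.
Import GroupScope.

(* For H :!=: 1 and H \subset G this amounts to normedTI H^# G 'N_G(H);
   normedTI itself excludes the trivial subgroup. *)
Definition TI_subgroup (gT : finGroupType) (G H : {group gT}) : Prop :=
  H \subset G
  /\ forall x, x \in G -> H :&: H :^ x = H \/ H :&: H :^ x = 1.

Definition has_normal_complement
    (gT : finGroupType) (X H : {group gT}) : Prop :=
  exists N : {group gT}, [/\ N <| X, N * H = X & N :&: H = 1].

(* K lives in its own type kT, unrelated to the ambient type of H, and a
   groupAction of H with range K is an action of H by automorphisms of K. *)
Definition Frobenius_complement
    (gT : finGroupType) (H : {group gT}) : Prop :=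
  exists (kT : finGroupType) (K : {group kT}) (to : groupAction H K),
    K :!=: 1 /\ forall h, h \in H^# -> 'C_(|to)[h] = 1.

(* Main.v *)
Require Import Defs.
From mathcomp Require Import all_boot all_fingroup all_solvable.
From mathcomp Require Import order ssralg zmodp vector ssrnum archimedean.
From mathcomp Require Import algC classfun character vcharacter.

(** Let N = 'N_G(H) and pi = \pi(H).

    Restricting a normal complement M of H from G to N is the modular law.
    For the converse, let K be a normal complement of H in N. As H and K are
    normal Hall subgroups of N, an element of N lies outside K exactly when its
    pi-part is a nontrivial element of H; since H is T.I., two such elements can
    only be conjugate in G under an element of N. So N :\: K is a T.I. set with
    normaliser N (for H <> 1), and the character-theoretic argument of Frobenius
    applies: the irreducible characters of N / K extend to irreducible characters of G
    that are trivial off the conjugates of N :\: K, and their common kernel M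
    satisfies M * N = G and M :&: N = K (generalized_Frobenius_kernel). Then
    M * H = M * K * H = G and M :&: H = 1.

    For the second part, let M be a normal complement of H in G. By the T.I.
    property every element of M that commutes with some nonidentity element of
    H normalises H, hence centralises H because [~: M, H] \subset M. So all
    nonidentity elements of H have the same centraliser in M, namely 'C_M(H),
    which is not M if H is not normal. The group 'C_M(H) need not be
    normal in M, so M cannot be divided by it; instead one finds, for
    every prime p, a Sylow p-subgroup P of M that H normalises, picks p such
    that H does not centralise P, and lets H act on 'N_P('C_P(H)) / 'C_P(H),
    which is nontrivial because normalisers grow in P. The action is coprime,
    so fixed points lift, and no element of H^# fixes a point other than 1
    (semiprime_nilpotent_Frobenius_complement).

    The H-invariant Sylow subgroup is obtained without any solvability
    assumption, hence without the conjugacy part of the Schur-Zassenhaus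
    theorem: the Frattini argument and the existence part give some complement
    of M in G that normalises a given Sylow subgroup, and TI_pi_subgroup shows,
    by counting, that every pi-subgroup of G is contained in a conjugate of H. *)

Set Implicit Arguments.
Unset Strict Implicit.
Unset Printing Implicit Defensive.
Import GroupScope.

(** * Extending characters from a T.I. set *)

Section ExceptionalCharacters.

Import Order.TTheory GRing.Theory Num.Theory.
Local Open Scope ring_scope.

Variables (gT : finGroupType) (G L : {group gT}).

(** In the induction formula at x \in A, a conjugator y contributes only if
    x ^ y \in A, and then y \in L and the term equals theta x. *)
Lemma cfInd_normedTI (A : {set gT}) (theta : 'CF(L)) :
  normedTI A G L -> theta \in 'CF(L, A) -> {in A, 'Ind[G] theta =1 theta}.
Proof.
case/normedTI_memJ_P=> _ sLG tiAG /cfun_onP theta0 x Ax.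
rewrite cfIndE // (big_setID L) /= (setIidPr sLG).
apply: canLR (mulKf (neq0CG L)) _.
rewrite [X in _ + X]big1 => [|y /setDP[Gy L'y]]; last first.
  by rewrite theta0 ?tiAG.
rewrite addr0 mulr_natl -sumr_const.
by apply: eq_bigr => y Ly; rewrite cfunJ.
Qed.

(** Subtracting a := 'chi_i 1 from 'chi_i leaves a function theta supported on
    A, for which induction is an isometry into the class functions that vanish off
    the conjugates of A. Hence 'Ind theta + a has norm 1 and value a > 0 at 1,
    so it is an irreducible character. *)
Lemma normedTI_irr_extension (A : {set gT}) (i : Iirr L) :
    normedTI A G L -> A \subset L^# -> L :\: A \subset cfker 'chi_i ->
  exists2 j : Iirr G, {in 1%g |: A, 'chi_j =1 'chi_i}
                    & G :\: class_support A G \subset cfker 'chi_j.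
Proof.
move=> tiA sAL kerA; have [_ sLG _] := normedTI_memJ_P tiA.
(* The orthogonality of 'chi_i and 1 used below fails for the principal
   character, which extends to the principal character. *)
have [->|nz_i] := eqVneq i 0.
  exists 0 => [x A1x|]; last by rewrite irr0 cfker_cfun1 subsetDl.
  have Lx: x \in L by case/setU1P: A1x => [->|/(subsetP sAL)/setD1P[]].
  by rewrite !irr0 !cfun1E (subsetP sLG) ?Lx.
pose a := 'chi_i 1%g; pose theta := 'chi_i - a%:A.
have A1: 1%g \notin A by apply/negP=> /(subsetP sAL); rewrite !inE eqxx.
have Atheta: theta \in 'CF(L, A).
  apply/cfun_onP=> x A'x; rewrite !cfunE cfun1E.
  have [Lx | L'x] := boolP (x \in L); last by rewrite cfun0 ?mulr0 ?subr0.
  by rewrite cfker1 ?mulr1 ?subrr // (subsetP kerA) // inE A'x.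
have indA := cfInd_normedTI tiA Atheta.
have ind_off x: x \notin class_support A G -> 'Ind[G] theta x = 0.
  by move: x; apply/cfun_onP; apply: cfInd_on.
have chi_i1: '['chi_i, 1] = 0 by rewrite -irr0 cfdot_irr (negPf nz_i).
have a_real: a^* = a by rewrite conj_natr // Cnat_irr1.
have norm_ind: '['Ind[G] theta] = 1 + a * a.
  rewrite -cfdot_Res_l (@eq_cfdotl _ _ A _ theta) //.
    rewrite cfnormBd ?cfnorm_irr ?cfnormZ ?cfnorm1 ?mulr1 ?normCK ?a_real //.
    by rewrite cfdotZr chi_i1 mulr0.
  move=> x Ax; have Lx: x \in L by case/setD1P: (subsetP sAL x Ax).
  by rewrite cfResE ?indA.
have ind_1: '['Ind[G] theta, 1] = - a.
  rewrite -cfdot_Res_r cfRes_cfun1 // cfdotBl chi_i1 cfdotZl cfnorm1 mulr1.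
  by rewrite sub0r.
pose phi := 'Ind[G] theta + a%:A.
have Zphi: phi \in 'Z[irr G].
  have Za: a \in Num.int by rewrite intrE Cnat_irr1.
  by rewrite rpredD ?cfInd_vchar ?rpredB ?irr_vchar // scale_zchar ?rpred1.
have norm_phi: '[phi] = 1.
  have d: '['Ind[G] theta, a%:A] = - (a * a).
    by rewrite cfdotZr ind_1 a_real mulrN.
  rewrite cfnormD d rmorphN rmorphM /= a_real norm_ind cfnormZ cfnorm1 mulr1.
  by rewrite normCK a_real !addrA !addrK.
have phi_off x: x \in G -> x \notin class_support A G -> phi x = a.
  by move=> Gx A'x; rewrite !cfunE ind_off // cfun1E Gx mulr1 add0r.
have A1G: 1%g \notin class_support A G.
  apply/imset2P=> -[x y Ax _ /esym/eqP]; rewrite conjg_eq1 => /eqP x1.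
  by rewrite -x1 Ax in A1.
have [j def_phi]: exists j, phi = 'chi_j.
  have [[] [j def_phi]] := vchar_norm1P Zphi norm_phi; last first.
    by exists j; rewrite def_phi scale1r.
  have: phi 1%g > 0 by rewrite phi_off // irr1_gt0.
  by rewrite def_phi scaleN1r cfunE oppr_gt0 lt_gtF ?irr1_gt0.
exists j => [x /setU1P[->|Ax]|].
- by rewrite -def_phi phi_off.
- have Lx: x \in L by case/setD1P: (subsetP sAL x Ax).
  by rewrite -def_phi !cfunE indA // !cfunE !cfun1E Lx (subsetP sLG) // subrK.
apply/subsetP=> x /setDP[Gx A'x].
by rewrite cfkerEirr inE -def_phi !phi_off.
Qed.

(** With K = 1 this is the theorem of Frobenius on the existence of the Frobenius
    kernel. Let A := L :\: K. The group M is the intersection of the kernels of all irreducible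
    characters of G that are trivial on B := G :\: class_support A G. It contains
    B; it misses A since a point of A is separated from 1 by a character of
    L / K, whose extension to G is trivial on B. Being normal, M then misses all
    conjugates of A, so that M = B. *)
Theorem generalized_Frobenius_kernel (K : {group gT}) :
    K <| L -> normedTI (L :\: K) G L ->
  exists M : {group gT},
    [/\ M <| G, M * L = G, M :&: L = K
      & M :=: G :\: class_support (L :\: K) G]%g.
Proof.
set A := L :\: K => nsKL tiA; have [sKL _] := andP nsKL.
have [_ sLG _] := normedTI_memJ_P tiA.
have sAL: A \subset L^# by rewrite setDS // sub1G.
have defLA: L :\: A = K by rewrite setDDr setDv set0U (setIidPr sKL).
set B := G :\: class_support A G.
pose M := [group of \bigcap_(j : Iirr G | B \subset cfker 'chi_j) cfker 'chi_j].
have nsMG: M <| G.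
  rewrite /normal (bigcap_min (0 : Iirr G)) ?cfker_sub //=; last first.
    by rewrite irr0 cfker_cfun1 subsetDl.
  by apply/norms_bigcap/bigcapsP=> j _; apply: cfker_norm.
have sMG := normal_sub nsMG.
have sBM: B \subset M by apply/bigcapsP.
have tiMA x: x \in M -> x \notin A.
  move=> Mx; apply/negP=> Ax; have [Lx /negP[]] := setDP Ax.
  rewrite -(cap_cfker_normal nsKL); apply/bigcapP=> i kerK.
  have [|j def_j kerB] := normedTI_irr_extension tiA sAL (i := i).
    by rewrite defLA.
  have: x \in cfker 'chi_j by apply: subsetP Mx; apply: (bigcap_min j).
  rewrite !cfkerEirr !inE.
  by rewrite !def_j ?setU11 // setU1r.
have defM: M :=: B.
  apply/eqP; rewrite eqEsubset sBM andbT; apply/subsetP=> x Mx.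
  rewrite inE (subsetP sMG) // andbT.
  apply/imset2P=> -[y z Ay Gz def_x]; move: Mx.
  rewrite def_x memJ_norm ?(subsetP (normal_norm nsMG)) // => /tiMA.
  by rewrite Ay.
have sMLK: M :&: L \subset K.
  by apply/subsetP=> x /setIP[/tiMA]; rewrite inE => /nandP[/negPn | /negP].
(* Comparing orders turns the inclusions M :&: L \subset K and M * L \subset G
   into equalities at once. *)
have oM: (#|M| * #|L| = #|K| * #|G|)%N.
  rewrite defM cardsD (setIidPr _); last first.
    by rewrite class_support_subG // (subset_trans (subsetDl _ _)).
  rewrite (card_support_normedTI tiA) cardsD (setIidPr sKL).
  rewrite -(Lagrange sLG) -mulnBl subKn ?subset_leq_card //.
  by rewrite -mulnA [(#|G : L| * _)%N]mulnC.
have sMLG: (M * L)%g \subset G by rewrite mul_subG.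
have le_KG : (#|K| * #|G| <= #|M :&: L| * #|(M * L)%g|)%N.
  by rewrite -oM mul_cardG mulnC.
have defMK: M :&: L = K.
  apply/eqP; rewrite eqEcard sMLK -(leq_pmul2r (cardG_gt0 G)).
  by rewrite (leq_trans le_KG) // leq_mul2l subset_leq_card ?orbT.
exists M; split=> //.
by apply/eqP; rewrite eqEcard sMLG -(leq_pmul2l (cardG_gt0 K)) -{2}defMK.
Qed.

End ExceptionalCharacters.

(** * The pi-subgroups of G when H is T.I. *)

Section TISubgroups.

Variables (gT : finGroupType) (G H : {group gT}).
Hypothesis tiH : TI_subgroup G H.

Lemma TI_subgroup_norm x g : x \in H^# -> g \in G -> x ^ g \in H -> g \in 'N(H).
Proof.
case: tiH => sHG tiHG /setD1P[ntx Hx] Gg Hxg.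
have [/setIidPl sHHg | tiHg] := tiHG _ Gg.
  by rewrite -groupV inE sub_conjgV.
have: x ^ g \in H :&: H :^ g by rewrite inE Hxg memJ_conjg.
by rewrite tiHg inE conjg_eq1 (negPf ntx).
Qed.

Lemma TI_subgroup_conj_eq x g k :
    x != 1 -> g \in G -> k \in G -> x \in H :^ g -> x \in H :^ k ->
  H :^ g = H :^ k.
Proof.
rewrite !mem_conjg => ntx Gg Gk Hxg Hxk.
have /normP nHgk: g * k^-1 \in 'N(H).
  apply: (@TI_subgroup_norm (x ^ g^-1)).
  - by rewrite !inE conjg_eq1 ntx.
  - by rewrite groupM ?groupV.
  - by rewrite -conjgM mulKg.
by rewrite -[in RHS]nHgk -conjsgM mulgKV.
Qed.

Hypothesis hallH : Hall 'N_G(H) H.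
Let pi := \pi(H).

(** The normaliser in G of a nontrivial Sylow subgroup S of H lies in 'N_G(H), by
    the T.I. property. So S is a Sylow subgroup of its own normaliser, hence
    of G. *)
Lemma TI_norm_Hall : pi.-Hall(G) H.
Proof.
case: tiH => sHG _; have hallN: pi.-Hall('N_G(H)) H by apply: Hall_pi.
rewrite pHallE sHG /= -[X in X == _](part_pnat_id (pgroup_pi H)); apply/eqP.
apply: eq_partn_from_log => // p pi_p; have [S sylS] := Sylow_exists p H.
suffices sylSG: p.-Sylow(G) S.
  by rewrite -logn_part -(card_Hall sylS) (card_Hall sylSG) logn_part.
have sylSN := subHall_Sylow hallN pi_p sylS.
have sSH := pHall_sub sylS; have sSG := subset_trans sSH sHG.
rewrite -Sylow_subnorm; apply: pHall_subl sylSN.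
  by rewrite subsetI sSG normG.
apply/subsetP=> g /setIP[Gg nSg]; rewrite inE Gg /=.
have /trivgPn[x Sx ntx]: S :!=: 1.
  by rewrite -cardG_gt1 (card_Hall sylS) p_part_gt1.
by rewrite (@TI_subgroup_norm x) ?inE ?ntx ?(subsetP sSH) ?memJ_norm.
Qed.

(** A pi-element that normalises a conjugate of H lies in it, H being a normal
    Hall pi-subgroup of 'N_G(H). *)
Lemma TI_subgroup_pi_mem x g y :
    g \in G -> x \in H :^ g -> x != 1 -> y \in G -> pi.-elt y ->
    x ^ y \in H :^ g ->
  y \in H :^ g.
Proof.
have [sHG _] := tiH; rewrite !mem_conjg => Gg Hx ntx Gy pi_y Hxy.
rewrite (mem_normal_Hall (Hall_pi hallH) (normalSG sHG)) ?p_eltJ //.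
rewrite inE groupJ ?groupV //=.
apply: (@TI_subgroup_norm (x ^ g^-1)); rewrite ?inE ?conjg_eq1 ?ntx //.
  by rewrite groupJ ?groupV.
by rewrite -conjJg.
Qed.

(** By Sylow's theorem a nontrivial primary part x.`_p lies in a conjugate of H;
    the element x commutes with x.`_p, hence normalises that conjugate. *)
Lemma TI_pi_elt x :
  x \in G -> pi.-elt x -> exists2 g, g \in G & x \in H :^ g.
Proof.
move=> Gx pi_x; have [-> | ntx] := eqVneq x 1.
  by exists 1; rewrite ?group1.
pose p := pdiv #[x]; have p_x: p \in \pi(#[x]) by rewrite pi_pdiv order_gt1.
have pi_p: p \in pi by apply: (pnatPpi pi_x).
have ntxp: x.`_p != 1.
  by rewrite -order_gt1 order_constt p_part_gt1.
have [g Gg]: exists2 g, g \in G & <[x.`_p]> \subset H :^ g.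
  apply: Hall_psubJ TI_norm_Hall pi_p _ (p_elt_constt p x).
  by rewrite cycle_subG groupX.
rewrite cycle_subG => Hxp; exists g => //.
apply: (TI_subgroup_pi_mem Gg Hxp) => //.
by rewrite /conjg -(commuteX _ (commute_refl x)) mulKg.
Qed.

(** The subgroups K g := X :&: H :^ g cover X. When nontrivial, K g is T.I. and
    self-normalising in X, so the conjugates of its nonidentity elements
    number #|X| - #|X : K g|. This is at least half of #|X|, so X^#, which has
    fewer than #|X| elements, has no room for two such disjoint sets: the
    conjugates of a single K g cover X, and then X = K g by the same count. *)
Lemma TI_pi_subgroup (X : {group gT}) :
  X \subset G -> pi.-group X -> exists2 g, g \in G & X \subset H :^ g.
Proof.
move=> sXG piX; have [-> | ntX] := eqsVneq X 1.
  by exists 1; rewrite ?group1 ?sub1G.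
have cover x : x \in X -> exists2 g, g \in G & x \in H :^ g.
  by move=> Xx; apply: TI_pi_elt (subsetP sXG x Xx) (mem_p_elt piX Xx).
pose K g := [group of X :&: H :^ g]; pose S g := class_support (K g)^# X.
have oS g : g \in G -> K g :!=: 1 -> #|S g| = (#|X| - #|X : K g|)%N.
  move=> Gg ntK; have tiK: normedTI (K g)^# X (K g).
    apply/normedTI_memJ_P; split; rewrite ?subsetIl ?setD_eq0 ?subG1 //.
    move=> a y; rewrite !inE conjg_eq1 => /and3P[nta Xa Ha] Xy.
    rewrite nta groupJ // Xy /=; apply/idP/idP=> [|Hy]; last exact: groupJ.
    apply: (TI_subgroup_pi_mem Gg Ha nta) => //; first exact: subsetP Xy.
    exact: mem_p_elt piX Xy.
  rewrite (card_support_normedTI tiK) cardsD (setIidPr _) ?sub1set ?group1 //.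
  by rewrite cards1 mulnBl mul1n Lagrange ?subsetIl.
have sSX g : S g \subset X^#.
  apply/subsetP=> _ /imset2P[a y /setD1P[nta /setIP[Xa _]] Xy ->].
  by rewrite !inE conjg_eq1 nta groupJ.
have half g : g \in G -> K g :!=: 1 -> #|X| <= 2 * #|S g|.
  move=> Gg ntK; have le2: 2 * #|X : K g| <= #|X|.
    by rewrite -(Lagrange (subsetIl X (H :^ g))) leq_mul2r cardG_gt1 ntK orbT.
  rewrite oS // mulnBr leq_subRL.
    by rewrite [in leqRHS]mul2n -addnn leq_add2r.
  by rewrite (leq_trans le2) // leq_pmull.
have [x Xx ntx] := trivgPn _ ntX; have [g Gg Hx] := cover x Xx.
have ntK k y : y \in X -> y != 1 -> y \in H :^ k -> K k :!=: 1.
  by move=> Xy nty Hy; apply/trivgPn; exists y; rewrite // inE Xy.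
have ntKg := ntK g x Xx ntx Hx.
have [defS | S'X] := eqVneq (S g) X^#.
  exists g => //; apply/setIidPl/(index1g (subsetIl X _)).
  have oX: #|X| = #|X^#|.+1 by rewrite (cardsD1 1 X) group1.
  rewrite -(subKn (dvdn_leq (cardG_gt0 X) (dvdn_indexg X (K g)))) -oS //.
  by rewrite defS oX subSnn.
have [y /setD1P[nty Xy] Sy]: exists2 y, y \in X^# & y \notin S g.
  by apply/subsetPn; rewrite eqEsubset sSX in S'X.
have [k Gk Hy] := cover y Xy; have ntKk := ntK k y Xy nty Hy.
(* If conjugates in X of K g and K k shared a nonidentity element, K g and K k
   would be conjugate in X, and y \in K k would lie in S g. *)
have tiS: S g :&: S k = set0.
  apply/eqP; rewrite -subset0; apply/subsetP=> z /setIP[].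
  case/imset2P=> a u /setD1P[nta /setIP[Xa Ha]] Xu def_z.
  case/imset2P=> b v /setD1P[ntb /setIP[Xb Hb]] Xv def_z'.
  case/negP: Sy.
  have defHk: H :^ (g * u * v^-1) = H :^ k.
    apply: (@TI_subgroup_conj_eq b) => //.
      by rewrite !groupM ?groupV // (subsetP sXG).
    by rewrite -mulgA conjsgM mem_conjg invMg invgK conjgM -def_z' def_z conjgK.
  apply/imset2P; exists (y ^ (v * u^-1)) (u * v^-1); rewrite ?groupM ?groupV //.
    have Xyvu: y ^ (v * u^-1) \in X by rewrite groupJ ?groupM ?groupV.
    rewrite !inE conjg_eq1 nty Xyvu /=.
    by rewrite -mem_conjgV invMg invgK -conjsgM mulgA defHk.
  by rewrite -conjgM mulgA mulgKV mulgV conjg1.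
have := leq_add (half g Gg ntKg) (half k Gk ntKk).
rewrite -mulnDr addnn -mul2n leq_pmul2l // -cardsUI tiS cards0 addn0 leqNgt.
case/negP; rewrite [#|X|](cardsD1 1) group1 ltnS subset_leq_card //.
by rewrite subUset !sSX.
Qed.

End TISubgroups.

(** * Semiprime actions and Frobenius complements *)

(** If D := 'C_P(H) is proper in P then it is proper in Q := 'N_P(D). By coprime
    action the fixed points of h \in H^# in Q / D come from 'C_Q[h], which is
    contained in D by semiprimality; so h acts on Q / D without fixed points. *)
Lemma semiprime_nilpotent_Frobenius_complement (gT : finGroupType)
    (P H : {group gT}) :
    nilpotent P -> H \subset 'N(P) -> coprime #|P| #|H| -> semiprime P H ->
    ~~ (P \subset 'C(H)) -> Frobenius_complement H.
Proof.
move=> nilP nPH coPH prPH not_cPH.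
pose D := 'C_P(H); pose Q := 'N_P(D).
have sDP: D \subset P by apply: subsetIl.
have prDQ: D \proper Q.
  apply: nilpotent_proper_norm => //; rewrite properEneq sDP andbT.
  by apply: contra not_cPH => /eqP/setIidPl.
have nDH: H \subset 'N(D).
  by rewrite cents_norm // centsC subsetIr.
have nQH: H \subset 'N(Q) by rewrite normsI ?norms_norm.
have nDQ: Q \subset 'N(D) by apply: subsetIr.
have actsQ_H: {acts H, on group (Q / D) | 'Q}.
  by split; [apply: actsQ | rewrite /= quotientS ?subsetT].
exists _, (Q / D)%G, <[actsQ_H]>%gact; split.
  by rewrite -subG1 /= quotient_sub1 // proper_subn.
move=> h /setD1P[nth Hh]; rewrite gacent_actby.
rewrite gacentQ (setIidPr (_ : [set h] \subset H)) ?sub1set //.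
rewrite -cent_gen -quotient_gen ?sub1set ?(subsetP nDH) //.
have sQP: Q \subset P by apply: subsetIl.
have shH: <[h]> \subset H by rewrite cycle_subG.
have nDh := subset_trans shH nDH.
have coQh: coprime #|Q| #|<[h]>| by apply: coprimegS shH (coprimeSg sQP coPH).
have solQ: solvable Q by apply: solvableS sQP (nilpotent_sol nilP).
rewrite -(coprime_quotient_cent (proper_sub prDQ) nDh coQh solQ).
apply/trivgP; rewrite quotient_sub1; last by rewrite subIset ?nDQ.
rewrite /= cent_cycle -(prPH h) ?inE ?nth //.
by rewrite setSI.
Qed.

(** * Normal complements of T.I. subgroups *)

Section NormalComplements.

Variables (gT : finGroupType) (G H : {group gT}).
Hypotheses (tiH : TI_subgroup G H) (hallH : Hall 'N_G(H) H).

(** The set 'N_G(H) :\: K consists of the elements of 'N_G(H) with nontrivial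
    pi-part, pi := \pi(H), and
    this pi-part lies in H; the T.I. property of H thus passes to that set. *)
Lemma TI_normal_complement_extends :
  has_normal_complement 'N_G(H)%G H -> has_normal_complement G H.
Proof.
have [sHG _] := tiH; have nsHN := normalSG sHG.
case=> K [nsKN defN tiKH].
(* For H = 1 the set 'N_G(H) :\: K is empty, so not a normedTI set. *)
have [H1 | ntH] := eqsVneq H 1.
  by exists G; rewrite H1 mulg1 normal_refl; split=> //; apply/setIidPr/sub1G.
pose pi := \pi(H); have hallH' : pi.-Hall('N_G(H)) H by apply: Hall_pi.
have hallK: pi^'.-Hall('N_G(H)) K.
  have [] := coprime_mulGp_Hall defN _ (pgroup_pi H) => //.
  have [_ _] := and3P hallH'; rewrite -divgS ?normal_sub //= -defN.
  by rewrite TI_cardMg // mulnK.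
have notK a : a \in 'N_G(H) -> (a \in K) = (a.`_pi == 1).
  by move=> Na; rewrite (mem_normal_Hall hallK) //; apply/constt1P/eqP.
have pi_part a : a \in 'N_G(H) -> a.`_pi \in H.
  by move=> Na; rewrite (mem_normal_Hall hallH') ?p_elt_constt ?groupX.
have tiA: normedTI ('N_G(H) :\: K) G 'N_G(H)%G.
  apply/normedTI_memJ_P; split; rewrite ?subsetIl //.
    have [h Hh nth] := trivgPn _ ntH; apply/set0Pn; exists h.
    rewrite inE (subsetP (normal_sub nsHN)) // andbT.
    by apply: contra nth => Kh; rewrite -in_set1 -set1gE -tiKH inE Kh.
  move=> a g /setDP[Na K'a] Gg; apply/idP/idP=> [/setDP[Nag _] | Ng].
    rewrite inE Gg; apply: (TI_subgroup_norm tiH (x := a.`_pi)) => //.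
      by rewrite !inE -notK // K'a pi_part.
    by rewrite -consttJ pi_part.
  by rewrite inE memJ_norm ?K'a ?groupJ // (subsetP (normal_norm nsKN)).
have [M [nsMG defG defMN _]] := generalized_Frobenius_kernel nsKN tiA.
have sKM: K \subset M by rewrite -defMN subsetIl.
exists M; split=> //; first by rewrite -(mulGSid sKM) -mulgA defN.
by rewrite -tiKH -defMN /= -setIA (setIidPr (normal_sub nsHN)).
Qed.

Lemma normal_complement_restricts :
  has_normal_complement G H -> has_normal_complement 'N_G(H)%G H.
Proof.
have [sHG _] := tiH; have nsHN := normalSG sHG; have sHN := normal_sub nsHN.
case=> M [nsMG defG tiMH]; exists ('N_G(H) :&: M)%G; split.
- exact: normalGI (subsetIl _ _) nsMG.
- by rewrite /= group_modr // defG; apply/setIidPl/subsetIl.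
by rewrite /= -setIA tiMH; apply/setIidPr/sub1G.
Qed.

Variable M : {group gT}.
Hypotheses (nsMG : M <| G) (defG : M * H = G) (tiMH : M :&: H = 1).

(** An element of M that commutes with some x \in H^# normalises H, and
    [~: 'N_M(H), H] \subset M :&: H = 1. *)
Lemma normal_complement_semiprime : semiprime M H.
Proof.
have [sMG nMG] := andP nsMG; have [sHG _] := tiH.
move=> x H1x; have [_ Hx] := setD1P H1x; apply/eqP; rewrite eqEsubset andbC.
rewrite setIS -?cent_set1 ?centS ?sub1set //= subsetI subsetIl /= cent_set1.
have nHC: 'C_M[x] \subset 'N(H).
  apply/subsetP=> y /setIP[My /cent1P cxy].
  apply: (TI_subgroup_norm tiH H1x); first exact: subsetP sMG y My.
  by rewrite /conjg -cxy mulKg.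
apply/commG1P/trivgP; rewrite -tiMH subsetI commg_subr nHC andbT.
rewrite (subset_trans (commSg H (subsetIl _ _))) // commg_subl.
exact: subset_trans sHG nMG.
Qed.

Lemma normal_complement_coprime : coprime #|M| #|H|.
Proof.
have [_ _] := and3P (TI_norm_Hall tiH hallH).
have [sHG _] := tiH; rewrite -divgS // -defG TI_cardMg // mulnK // => pi'M.
by rewrite coprime_sym (pnat_coprime (pgroup_pi H)).
Qed.

(** By the Frattini argument and the existence part of the Schur-Zassenhaus
    theorem, 'N_G(P) contains a complement H1 of M in G. As H1 and H have the
    same order, H1 is a conjugate of H by TI_pi_subgroup, and the
    conjugation that takes H1 to H takes P to a Sylow subgroup normalised by H. *)
Lemma normal_complement_Sylow_exists p :
  exists2 P : {group gT}, p.-Sylow(M) P & H \subset 'N(P).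
Proof.
have [sMG nMG] := andP nsMG; have [P sylP] := Sylow_exists p M.
have [sHG _] := tiH.
pose N := 'N_G(P)%G; pose MN := (N :&: M)%G.
have nsMN: MN <| N by apply: normalGI (subsetIl _ _) nsMG.
have defMN : M * N = G := Frattini_arg nsMG sylP.
have iMN: #|N : MN| = #|H|.
  have := mul_cardG M N; rewrite defMN -defG TI_cardMg // setIC -mulnA => /eqP.
  rewrite eqn_pmul2l // => /eqP oN.
  by rewrite -divgS ?subsetIl // oN mulnK.
have coMN: coprime #|MN| #|H|.
  by apply: coprimeSg normal_complement_coprime; apply: subsetIr.
have /splitsP[H1 /complP[tiMNH1 defN]]: [splits N, over MN].
  by rewrite SchurZassenhaus_split // /Hall normal_sub // iMN.
have oH1: #|H1| = #|H|.
  by rewrite -iMN -divgS ?subsetIl // -defN TI_cardMg // mulKn.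
have sH1N: H1 \subset N by rewrite -defN mulG_subr.
have [||g Gg sH1H] := TI_pi_subgroup tiH hallH (X := H1).
- exact: subset_trans sH1N (subsetIl _ _).
- by rewrite /pgroup oH1; apply: pgroup_pi.
exists (P :^ g^-1)%G.
  by rewrite pHallJnorm // (subsetP nMG) ?groupV.
have defHg: H :^ g = H1 by apply/eqP; rewrite eq_sym eqEcard sH1H cardJg oH1 /=.
rewrite /= normJ -sub_conjg defHg.
by apply: subset_trans sH1N (subsetIr _ _).
Qed.

(** If H centralised an invariant Sylow p-subgroup for every p, then #|M| would
    divide #|'C_M(H)|, so M would centralise H and H would be normal in G. *)
Lemma TI_nonnormal_Frobenius_complement :
  ~~ (H <| G) -> Frobenius_complement H.
Proof.
have [sHG _] := tiH; move=> not_nHG.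
have /allPn[p _ not_dv]:
    ~~ all (fun p : nat => #|M|`_p %| #|'C_M(H)|) (primes #|M|).
  apply: contra not_nHG => /allP dv.
  rewrite /normal sHG -defG mulG_subG normG andbT.
  have dvM: #|M| %| #|'C_M(H)| by apply/dvdn_partP.
  rewrite cents_norm //; apply/setIidPl/eqP.
  by rewrite eqEcard subsetIl dvdn_leq.
have [P sylP nPH] := normal_complement_Sylow_exists p.
have sPM := pHall_sub sylP.
apply: semiprime_nilpotent_Frobenius_complement nPH _ _ _.
- exact: pgroup_nil (pHall_pgroup sylP).
- exact: coprimeSg sPM normal_complement_coprime.
- exact: semiprimeS sPM (subxx _) normal_complement_semiprime.
apply: contra not_dv => cHP.
by rewrite -(card_Hall sylP) cardSg // subsetI sPM.
Qed.

End NormalComplements.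

Theorem theorem1p8 (gT : finGroupType) (G H : {group gT})
    (tiH : TI_subgroup G H) (hallH : Hall 'N_G(H) H) :
  (has_normal_complement 'N_G(H)%G H <-> has_normal_complement G H)
  /\ (~~ (H <| G) -> has_normal_complement 'N_G(H)%G H ->
      Frobenius_complement H).
Proof.
have ext := TI_normal_complement_extends tiH hallH.
split; first by split; [exact: ext | exact: normal_complement_restricts].
move=> not_nHG /ext[M [nsMG defG tiMH]].
exact: TI_nonnormal_Frobenius_complement nsMG defG tiMH not_nHG.
Qed.
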